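(* Let $m, C \in \mathbb{N}$ be positive, let $H \in \mathbb{R}^{m\times m}$ be symmetric positive definite, $F \in \mathbb{R}^m$, $A \in \mathbb{R}^{m \times C}$ and $B \in \mathbb{R}^C$. Consider the quadratic program $$\min_{u \in \mathbb{R}^m} \left\{ u^\top H u + F^\top u \right\} \quad \text{s.t.} \quad A^\top u \le B .$$ Let $\Lambda = \{ x \in \mathrm{null}(A) \subset \mathbb{R}^C \mid x \ge 0 \}$ and let $d^\star$ be the optimal value of the linear program $$d^\star = \max_{\lambda \in \Lambda} \left\{ -B^\top \lambda \right\}.$$ Then the quadratic program is feasible if and only if the value of this linear program is bounded, i.e. $d^\star < \infty$.
   Context: Vector inequalities are componentwise. $\mathrm{null}(A) = \{x \in \mathbb{R}^C : A x = 0\}$ is the null space of $A$. The quadratic program is called feasible if its constraint set $\{u \in \mathbb{R}^m : A^\top u \le B\}$ is nonempty. The value $d^\star$ is understood as the supremum of $-B^\top\lambda$ over $\lambda\in\Lambda$, taken in $\mathbb{R}\cup\{+\infty\}$ (equal to $+\infty$ when the linear program is unbounded). *)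

(* Defs.v *)
From mathcomp Require Import all_boot all_order all_algebra.
From mathcomp Require Import all_classical all_reals ereal.

Set Implicit Arguments.
Unset Strict Implicit.
Unset Printing Implicit Defensive.

Import Order.TTheory GRing.Theory Num.Theory.

Local Open Scope classical_set_scope.
Local Open Scope ring_scope.

Definition lecv (R : realType) (n : nat) (x y : 'cV[R]_n) : Prop :=
  forall i, x i 0 <= y i 0.

Definition posdefmx (R : realType) (n : nat) (H : 'M[R]_n) : Prop :=
  forall x : 'cV[R]_n, x != 0 -> 0 < (x^T *m H *m x) 0 0.

(* The direction of optimization is not recorded: it is chosen by the value one
   takes of the program. *)
Record program (R : realType) (T : Type) : Type := Program {
  objective : T -> R;
  constraint_set : set T }.

Definition feasible (R : realType) (T : Type) (P : program R T) : Prop :=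
  constraint_set P !=set0.

(* The value of P as a maximization problem: no attainment is required, and it
   is -oo on an empty constraint set, +oo when P is unbounded above. *)
Definition max_value (R : realType) (T : Type) (P : program R T) : \bar R :=
  ereal_sup [set (objective P x)%:E | x in constraint_set P].

Definition quadratic_program (R : realType) (m C : nat) (H : 'M[R]_m)
    (F : 'cV[R]_m) (A : 'M[R]_(m, C)) (B : 'cV[R]_C) : program R 'cV[R]_m :=
  Program (fun u => (u^T *m H *m u + F^T *m u) 0 0)
          [set u | lecv (A^T *m u) B].

Definition null_space (R : realType) (m C : nat) (A : 'M[R]_(m, C)) :
    set 'cV[R]_C :=
  [set x | A *m x = 0].

Definition Lambda (R : realType) (m C : nat) (A : 'M[R]_(m, C)) :
    set 'cV[R]_C :=
  [set x | null_space A x /\ lecv 0 x].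

Definition linear_program (R : realType) (m C : nat) (A : 'M[R]_(m, C))
    (B : 'cV[R]_C) : program R 'cV[R]_C :=
  Program (fun lam => - (B^T *m lam) 0 0) (Lambda A).

(* Main.v *)
Require Import Defs.
From mathcomp Require Import all_boot all_order all_algebra.
From mathcomp Require Import all_classical all_reals ereal.
From mathcomp Require Import lra.

(** Since [Lambda] is a cone, the linear program is bounded if and only if
    [B^T l >= 0] for every [l] in [Lambda]; by Gale's theorem of the alternative
    this is equivalent to the solvability of [A^T u <= B].  Gale's theorem
    follows by Fourier-Motzkin elimination: every inequality of the system with
    one variable eliminated is a nonnegative combination of the original ones,
    so that a certificate of infeasibility pulls back. *)

Set Implicit Arguments.
Unset Strict Implicit.
Unset Printing Implicit Defensive.

Import Order.TTheory GRing.Theory Num.Theory.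

Local Open Scope ring_scope.

(** The largest [f p] works as [t]; if [P] is empty, the smallest [g q] does. *)
Lemma exists_between_fin (R : realFieldType) (I : finType) (P Q : pred I)
    (f g : I -> R) :
  (forall p q, P p -> Q q -> f p <= g q) ->
  exists t, (forall p, P p -> f p <= t) /\ (forall q, Q q -> t <= g q).
Proof.
move=> fg; case: (pickP P) => [p0 Pp0|P0].
  case: (Order.TotalTheory.arg_maxP f Pp0) => p Pp maxp.
  by exists (f p); split=> // q; exact: fg.
case: (pickP Q) => [q0 Qq0|Q0].
  case: (Order.TotalTheory.arg_minP g Qq0) => q Qq minq.
  by exists (g q); split=> // p; rewrite P0.
by exists 0; split=> i; rewrite ?P0 ?Q0.
Qed.

Lemma sum_combination (R : comPzRingType) (I J : finType) (l : J -> R)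
    (w : J -> I -> R) (f : I -> R) :
  \sum_i (\sum_j l j * w j i) * f i = \sum_j l j * \sum_i w j i * f i.
Proof.
under eq_bigr => i _ do rewrite mulr_suml.
rewrite exchange_big /=; apply: eq_bigr => j _; rewrite mulr_sumr.
by apply: eq_bigr => i _; rewrite mulrA.
Qed.

Lemma sum_delta (R : pzRingType) (I : finType) (f : I -> R) (i : I) :
  \sum_k (k == i)%:R * f k = f i.
Proof.
rewrite (bigD1 i) //= eqxx mul1r big1 ?addr0 // => k /negPf ->.
by rewrite mul0r.
Qed.

(** The elimination of a variable with coefficients [c] keeps the inequalities
    in which it does not occur, and combines each inequality where its
    coefficient is positive with each one where it is negative; the remaining
    indices get the zero combination. *)
Definition fm_weight (R : realFieldType) (I : finType) (c : I -> R)
    (s : I + I * I) (k : I) : R :=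
  match s with
  | inl i => if c i == 0 then (k == i)%:R else 0
  | inr (p, q) => if (0 < c p) && (c q < 0)
                  then c p * (k == q)%:R - c q * (k == p)%:R else 0
  end.

Lemma fm_weight_ge0 (R : realFieldType) (I : finType) (c : I -> R) s k :
  0 <= fm_weight c s k.
Proof.
case: s => [i|[p q]] /=; first by case: ifP; rewrite ?ler0n.
case: ifP => // /andP[cp cq].
by rewrite -mulNr addr_ge0 ?mulr_ge0 ?ler0n ?oppr_ge0 // ltW.
Qed.

Lemma sum_fm_weight_inl (R : realFieldType) (I : finType) (c f : I -> R) i :
  c i = 0 -> \sum_k fm_weight c (inl i) k * f k = f i.
Proof. by move=> ci; rewrite /= ci eqxx sum_delta. Qed.

Lemma sum_fm_weight_inr (R : realFieldType) (I : finType) (c f : I -> R) p q :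
  0 < c p -> c q < 0 ->
  \sum_k fm_weight c (inr (p, q)) k * f k = c p * f q - c q * f p.
Proof.
move=> cp cq; rewrite /= cp cq /=.
under eq_bigr => k _ do rewrite mulrBl -!mulrA.
by rewrite sumrB -!mulr_sumr !sum_delta.
Qed.

Lemma sum_fm_weight_eliminated (R : realFieldType) (I : finType) (c : I -> R)
    (s : I + I * I) :
  \sum_k fm_weight c s k * c k = 0.
Proof.
case: s => [i|[p q]].
  have [ci|ci] := eqVneq (c i) 0; first by rewrite sum_fm_weight_inl.
  by apply: big1 => k _; rewrite /= (negPf ci) mul0r.
have [/andP[cp cq]|/negPf cpq] := boolP ((0 < c p) && (c q < 0)).
  by rewrite sum_fm_weight_inr // mulrC subrr.
by apply: big1 => k _; rewrite /= cpq mul0r.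
Qed.

(** Rows with [c i < 0] bound [t] below by [r i / c i], rows with [0 < c i] bound it above. The
    paired weights say that no lower bound exceeds an upper one; the single weights settle the rows
    with [c i = 0]. *)
Lemma fm_solve (R : realFieldType) (I : finType) (c r : I -> R) :
  (forall s, 0 <= \sum_k fm_weight c s k * r k) ->
  exists t, forall i, c i * t <= r i.
Proof.
move=> wr.
have [p q|t [lo up]] := @exists_between_fin R I (fun i => c i < 0)
    (fun i => 0 < c i) (fun i => r i / c i) (fun i => r i / c i).
  move=> cp cq; move: (wr (inr (q, p))); rewrite sum_fm_weight_inr // => h.
  by rewrite ler_pdivlMr // mulrAC ler_ndivrMr //; lra.
exists t => i; case: (ltgtP (c i) 0) => ci.
- by have := lo i ci; rewrite ler_ndivrMr // mulrC.
- by have := up i ci; rewrite ler_pdivlMr // mulrC.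
- by rewrite ci mul0r -(sum_fm_weight_inl r ci).
Qed.

Theorem gale_alternative (R : realFieldType) (n : nat) (I : finType)
    (a : I -> 'I_n -> R) (b : I -> R) :
  (forall l : I -> R, (forall i, 0 <= l i) ->
     (forall j, \sum_i l i * a i j = 0) -> 0 <= \sum_i l i * b i) ->
  exists u : 'I_n -> R, forall i, \sum_j a i j * u j <= b i.
Proof.
elim: n I a b => [|n IHn] I a b certificate.
  (* Without variables every nonnegative [l] is a certificate, in particular the indicator of [i],
     which yields [0 <= b i]. *)
  exists (fun=> 0) => i; rewrite big_ord0 -(sum_delta b i).
  by apply: certificate => [k|[]//]; rewrite ler0n.
pose w := fm_weight (a^~ ord0).
have [l l_ge0 la|u hu] := IHn _
    (fun s j => \sum_k w s k * a k (lift ord0 j)) (fun s => \sum_k w s k * b k).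
  (* The multipliers [l] of the eliminated system pull back to [\sum_s l s * w s k] on the original
     rows. *)
  rewrite -sum_combination; apply: certificate => [k|j].
    by apply: sumr_ge0 => s _; rewrite mulr_ge0 ?fm_weight_ge0.
  rewrite sum_combination; case: (unliftP ord0 j) => [j'|] -> //.
  by apply: big1 => s _; rewrite sum_fm_weight_eliminated mulr0.
(* Back-substitution: with [u] fixed, only the variable [ord0] remains to be chosen. *)
have [s|t ht] := @fm_solve R I (a^~ ord0)
    (fun k => b k - \sum_j a k (lift ord0 j) * u j).
  under eq_bigr => k _ do rewrite mulrBr.
  rewrite sumrB subr_ge0; apply: le_trans (hu s); rewrite le_eqVlt.
  apply/orP; left; apply/eqP.
  under eq_bigr => k _ do rewrite mulr_sumr.
  rewrite exchange_big /=; apply: eq_bigr => j _; rewrite mulr_suml.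
  by apply: eq_bigr => k _; rewrite mulrA.
exists (fun j => if unlift ord0 j is Some j' then u j' else t) => i.
rewrite big_ord_recl unlift_none -lerBrDr.
by under eq_bigr => j _ do rewrite liftK.
Qed.

Lemma gale_alternative_mx (R : realType) (m C : nat) (A : 'M[R]_(m, C))
    (B : 'cV[R]_C) :
  (forall l, Lambda A l -> 0 <= (B^T *m l) 0 0) ->
  exists u : 'cV[R]_m, lecv (A^T *m u) B.
Proof.
move=> certificate.
have [l l_ge0 lA|u hu] := @gale_alternative R m 'I_C
    (fun i j => A j i) (fun i => B i 0).
  have := certificate (\col_i l i); rewrite mxE.
  under eq_bigr => i _ do rewrite !mxE mulrC.
  apply; split=> [|i]; last by rewrite !mxE.
  apply/matrixP => i j; rewrite !mxE -[RHS](lA i).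
  by apply: eq_bigr => k _; rewrite mxE mulrC.
exists (\col_j u j) => i; rewrite mxE; apply: le_trans (hu i).
by under eq_bigr => j _ do rewrite !mxE.
Qed.

Lemma weak_duality (R : realType) (m C : nat) (A : 'M[R]_(m, C))
    (B l : 'cV[R]_C) (u : 'cV[R]_m) :
  lecv (A^T *m u) B -> Lambda A l -> 0 <= (B^T *m l) 0 0.
Proof.
move=> uB [Al l_ge0].
(* Writing 0 as [u^T A l] reduces the claim to a termwise comparison of [A^T u] with [B], weighted
   by [l]. *)
have <- : ((A^T *m u)^T *m l) 0 0 = 0.
  by rewrite trmx_mul trmxK -mulmxA Al mulmx0 mxE.
rewrite !mxE; apply: ler_sum => i _; rewrite ![_^T _ _]mxE.
by apply: ler_wpM2r; [have := l_ge0 i; rewrite mxE|exact: uB].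
Qed.

Lemma Lambda_scale (R : realType) (m C : nat) (A : 'M[R]_(m, C))
    (t : R) (l : 'cV[R]_C) :
  0 <= t -> Lambda A l -> Lambda A (t *: l).
Proof.
move=> t_ge0 [Al l_ge0]; split=> [|i].
  by rewrite /null_space /= -scalemxAr Al scaler0.
by have := l_ge0 i; rewrite !mxE; exact: mulr_ge0.
Qed.

Lemma bounded_linear_program (R : realType) (m C : nat) (A : 'M[R]_(m, C))
    (B l : 'cV[R]_C) :
  (max_value (linear_program A B) < +oo)%E -> Lambda A l ->
  0 <= (B^T *m l) 0 0.
Proof.
move=> bounded Al; rewrite leNgt; apply/negP; set v := _ 0 0 => v_lt0.
have ub t : 0 <= t -> ((- (t * v))%:E <= max_value (linear_program A B))%E.
  move=> t_ge0; apply: ereal_sup_ubound; exists (t *: l).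
    exact: Lambda_scale.
  by rewrite /= -scalemxAr mxE.
(* The value [-oo] is excluded by the multiple [t = 0]. *)
move: bounded ub; case: (max_value _) => [d _|//|_] ub; last first.
  by have := ub 0 (lexx _).
have d_ge0 : 0 <= d by have := ub 0 (lexx _); rewrite lee_fin mul0r oppr0.
(* This multiple of [l] has objective value [d + 1], above the supremum [d]. *)
have t_ge0 : 0 <= (d + 1) / - v by rewrite divr_ge0 ?oppr_ge0 ?ltW //; lra.
have := ub _ t_ge0; rewrite lee_fin -mulrN divfK ?oppr_eq0 ?lt_eqF //.
by rewrite gerDl ler10.
Qed.

Theorem theorem1 (R : realType) (m C : nat) (hm : (0 < m)%N) (hC : (0 < C)%N)
    (H : 'M[R]_m) (F : 'cV[R]_m) (A : 'M[R]_(m, C)) (B : 'cV[R]_C)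
    (Hsym : H \is symmetricmx) (Hpos : posdefmx H) :
  feasible (quadratic_program H F A B) <->
  (max_value (linear_program A B) < +oo)%E.
Proof.
split=> [[u uB]|bounded].
  apply: (@le_lt_trans _ _ 0%E); last exact: ltry.
  apply: ge_ereal_sup => _ [l Al <-].
  by rewrite lee_fin oppr_le0; exact: weak_duality uB Al.
apply: gale_alternative_mx => l; exact: bounded_linear_program.
Qed.
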